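(* Let $l,m$ be positive integers. The quotient complex $\Delta(B_{lm})/S_l\wr S_m$ is collapsible.
   Context: $B_n$ is the Boolean algebra of all subsets of $\{1,\dots,n\}$ ordered by inclusion, and $\Delta(B_n)$ is the simplicial complex whose faces are the chains $u_0<\dots<u_i$ of elements of $B_n\setminus\{\emptyset,\{1,\dots,n\}\}$ (the empty chain being the empty face). The wreath product $S_l\wr S_m\subset S_{lm}$ is the subgroup of order $(l!)^m m!$ consisting of the permutations of $\{1,\dots,lm\}$ that preserve the partition of $\{1,\dots,lm\}$ into the $m$ sets (''rows'') $\{il+1,\dots,(i+1)l\}$, $0\le i<m$; that is, it permutes the elements within each row and permutes the rows wholesale. It acts on $B_{lm}$, hence on $\Delta(B_{lm})$. The quotient complex $\Delta(B_{lm})/S_l\wr S_m$ is the regular cell complex whose cells (faces) are the $S_l\wr S_m$-orbits of faces of $\Delta(B_{lm})$, with an orbit contained in another if some representative of the first is contained in a representative of the second. (It does not coincide with the order complex of the quotient poset.) It is a boolean cell complex: every lower interval in its face poset, which includes the empty face, is a Boolean algebra. A boolean cell complex is collapsible if it can be reduced to a single vertex by a sequence of elementary collapses, where an elementary collapse removes a pair of nonempty faces $\tau\subset\rho$ with $\dim\rho=\dim\tau+1$ such that $\rho$ is the only face properly containing $\tau$.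
   Formalization: The case l = m = 1 is excluded (lm > 1 is assumed): there the complex has only the empty face, so it cannot be reduced to a single vertex and the claim as stated fails. *)

(* Defs.v *)
From HB Require Import structures.
From mathcomp Require Import all_boot all_order all_fingroup.

Set Implicit Arguments.
Unset Strict Implicit.
Unset Printing Implicit Defensive.

Import Order.Theory GroupScope.
Local Open Scope nat_scope.
Local Open Scope order_scope.

(** A finite cell complex is given by its face poset, whose bottom element is
    the empty face. *)
Section Collapsibility.
Context {disp : Order.disp_t}.
Implicit Types (P : finBPOrderType disp).

Definition boolean_cell_complex P : Prop :=
  forall x : P, exists (T : finType) (f : {set T} -> P),
    (forall A B, (f A <= f B) = (A \subset B)) /\
    (forall y, y <= x <-> exists A, y = f A).

Definition vertex P (v : P) : bool :=
  (v != \bot) && [forall s : P, (s < v) ==> (s == \bot)].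

(* The cells of a boolean cell complex are simplices, so that
   dim x = nverts x - 1, with dim \bot = -1. See also
   [nverts_quotient_complex]. *)
Definition nverts P (x : P) : nat := #|[set v : P | vertex v & v <= x]|.

Definition elementary_collapse P : rel {set P} := fun K L =>
  [exists t in K, exists r in K,
    [&& t != \bot, t < r, nverts r == (nverts t).+1,
        [forall s in K, (t < s) ==> (s == r)] & L == K :\: [set t; r]]].

Definition collapsible P : Prop :=
  exists2 v : P, vertex v &
    connect (@elementary_collapse P) [set: P] [set \bot; v].

End Collapsibility.

Lemma nverts_boolean disp (P : finBPOrderType disp) (x : P) (T : finType)
    (f : {set T} -> P) :
  (forall A B, (f A <= f B) = (A \subset B)) ->
  (forall y, y <= x <-> exists A, y = f A) -> nverts x = #|T|.
Proof.
move=> fle fx.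
have finj : injective f.
  by move=> A B AB; apply/eqP; rewrite eqEsubset -!fle AB lexx.
have f0 : f set0 = \bot.
  have /fx[A A0] : \bot <= x by exact: le0x.
  by apply/le_anti; rewrite le0x {1}A0 fle sub0set.
have vertexf A : vertex (f A) -> exists u, A = [set u].
  case/andP; rewrite -f0 (inj_eq finj) => /set0Pn[u uA] /forallP/(_ (f [set u])).
  rewrite lt_neqAle !(inj_eq finj) fle sub1set uA andbT.
  case: eqVneq => [<-|_] /=; first by exists u.
  by move/eqP/setP/(_ u); rewrite !inE eqxx.
have f1_inj : injective (fun u => f [set u]) by move=> u v /finj/set1_inj.
rewrite -cardsT -(card_imset _ f1_inj); apply: eq_card => v; rewrite inE.
apply/andP/imsetP => [[vv /fx[A vA]]|[u _ ->]].
  by move: vv; rewrite vA => /vertexf[u ->]; exists u.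
split; last by apply/fx; exists [set u].
apply/andP; split.
  by rewrite -f0 (inj_eq finj); apply/set0Pn; exists u; rewrite inE.
apply/forallP => s; apply/implyP => su.
have /fx[A sA] : s <= x by apply: le_trans (ltW su) _; apply/fx; exists [set u].
move: su; rewrite sA lt_neqAle fle (inj_eq finj) subset1 => /andP[/negPf->] /=.
by rewrite -f0 => /eqP->.
Qed.

Section QuotientComplex.
Variables (n : nat) (G : {group 'S_n}).

(* A chain is encoded by the set of its elements; ['P^*^*] is the action of
   permutations of ['I_n] on sets of subsets of ['I_n]. *)
Definition chains : {set {set {set 'I_n}}} :=
  [set c : {set {set 'I_n}} | [&& set0 \notin c, setT \notin c &
    [forall u in c, forall v in c, (u \subset v) || (v \subset u)]]].

Definition qfaces : {set {set {set {set 'I_n}}}} :=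
  [set orbit ('P^* ^* )%act G c | c in chains].

Definition quotient_complex := {x : {set {set {set 'I_n}}} | x \in qfaces}.

HB.instance Definition _ := Finite.on quotient_complex.

Definition qface_le : rel quotient_complex := fun x y =>
  [exists c in val x, exists d in val y, c \subset d].

Local Notation act := ('P^* ^* )%act.

Lemma set0_chain : set0 \in chains.
Proof. by rewrite inE !in_set0 /=; apply/forall_inP => u; rewrite in_set0. Qed.

Lemma card_act (u : {set 'I_n}) (g : 'S_n) : #|('P^* )%act u g| = #|u|.
Proof. exact: card_setact. Qed.

Lemma qfaceP (x : quotient_complex) (c : {set {set 'I_n}}) : c \in val x ->
  c \in chains /\ val x = orbit act G c.
Proof.
have /imsetP[d dch ->] := valP x => /[dup] cd /orbit_eqP ->; split=> //.
have /orbitP[g _ <-] := cd.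
move: dch; rewrite !inE => /and3P[d0 dT /forall_inP dC]; apply/and3P; split.
- apply: contra d0 => /imsetP[u ud u0].
  by suff -> : set0 = u by []; apply/esym/eqP; rewrite -cards_eq0 -(card_act u g) -u0 cards0.
- apply: contra dT => /imsetP[u ud uT].
  suff -> : setT = u by [].
  by apply/esym/eqP; rewrite eqEcard subsetT -(card_act u g) -uT leqnn.
apply/forall_inP => _ /imsetP[u ud ->]; apply/forall_inP => _ /imsetP[v vd ->].
have /forall_inP/(_ _ vd)/orP[uv|uv] := dC _ ud; apply/orP; [left|right];
  exact: imsetS.
Qed.

Lemma qface_ex (x : quotient_complex) : exists c, c \in val x.
Proof. by have /imsetP[d dch ->] := valP x; exists d; apply: orbit_refl. Qed.

Lemma qface_leP (x y : quotient_complex) (d : {set {set 'I_n}}) :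
  d \in val y -> reflect (exists2 c, c \in val x & c \subset d) (qface_le x y).
Proof.
move=> dy; have [_ yE] := qfaceP dy.
apply: (iffP exists_inP) => [[c cx /exists_inP[e]]|[c cx cd]]; last first.
  by exists c => //; apply/exists_inP; exists d.
rewrite yE => /orbitP[g gG <-] cdg; exists (act c g^-1).
  by have [_ ->] := qfaceP cx; apply: mem_orbit; rewrite groupV.
by rewrite -(actK act g d); apply: imsetS.
Qed.

Lemma qface_le_refl : reflexive qface_le.
Proof. by move=> x; have [c cx] := qface_ex x; apply/(qface_leP _ cx); exists c. Qed.

Lemma qface_le_trans : transitive qface_le.
Proof.
move=> y x z; have [d dz] := qface_ex z; move=> xy /(qface_leP _ dz)[c cy cd].
have /(qface_leP _ cy)[b bx bc] := xy.
by apply/(qface_leP _ dz); exists b => //; apply: subset_trans cd.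
Qed.

Lemma card_qface (x : quotient_complex) c d :
  c \in val x -> d \in val x -> #|c| = #|d|.
Proof.
move=> cx; have [_ ->] := qfaceP cx; case/orbitP => g _ <-.
by rewrite card_setact.
Qed.

Lemma qface_le_anti : antisymmetric qface_le.
Proof.
move=> x y /andP[]; have [d dy] := qface_ex y.
case/(qface_leP _ dy) => c cx cd; case/(qface_leP _ cx) => e ey ec.
have cdE : c = d.
  by apply/eqP; rewrite eqEcard cd (card_qface dy ey) subset_leq_card.
apply: val_inj; have [_ ->] := qfaceP cx; have [_ ->] := qfaceP dy.
by rewrite cdE.
Qed.

Fact quotient_complex_display : Order.disp_t. Proof. exact: Order.Disp tt tt. Qed.

HB.instance Definition _ :=
  Order.Le_isPOrder.Build quotient_complex_display quotient_complex
    qface_le_refl qface_le_anti qface_le_trans.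

Definition chain_face c (cch : c \in chains) : quotient_complex :=
  Sub (orbit act G c) (imset_f (orbit act G) cch).

Lemma qface_le0 (x : quotient_complex) : chain_face set0_chain <= x.
Proof.
have [d dx] := qface_ex x; apply/(qface_leP _ dx); exists set0.
  exact: orbit_refl.
exact: sub0set.
Qed.

HB.instance Definition _ :=
  Order.hasBottom.Build quotient_complex_display quotient_complex qface_le0.

Lemma subset_chains (c d : {set {set 'I_n}}) :
  c \subset d -> d \in chains -> c \in chains.
Proof.
move=> /subsetP cd; rewrite !inE => /and3P[d0 dT /forall_inP dC].
apply/and3P; split; [exact: contra (cd _) d0|exact: contra (cd _) dT|].
apply/forall_inP => u /cd ud; apply/forall_inP => v /cd vd.
by have /forall_inP := dC _ ud; apply.
Qed.

Lemma chain_card_inj (c : {set {set 'I_n}}) : c \in chains ->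
  {in c &, injective (fun u : {set 'I_n} => #|u|)}.
Proof.
rewrite inE => /and3P[_ _ /forall_inP cC] u v uc vc uv.
have /forall_inP/(_ _ vc)/orP[s|s] := cC _ uc; apply/eqP.
  by rewrite eqEcard s uv leqnn.
by rewrite eq_sym eqEcard s uv leqnn.
Qed.

Lemma chain_face_le (c a b : {set {set 'I_n}}) (cch : c \in chains)
    (ach : a \in chains) (bch : b \in chains) :
  a \subset c -> b \subset c ->
  (chain_face ach <= chain_face bch) = (a \subset b).
Proof.
move=> /subsetP ac /subsetP bc; have bb : b \in val (chain_face bch).
  exact: orbit_refl.
apply/(qface_leP _ bb)/idP => [[_ /orbitP[g _ <-] /subsetP ab]|ab]; last first.
  by exists a => //; apply: orbit_refl.
apply/subsetP => u ua; have ugb : ('P^* )%act u g \in b by apply/ab/imset_f.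
suff <- : ('P^* )%act u g = u by [].
by apply: (chain_card_inj cch); [exact: bc|exact: ac|exact: card_act].
Qed.

End QuotientComplex.

Lemma qface_interval n (G : {group 'S_n}) (x : quotient_complex G)
    (c : {set {set 'I_n}}) : c \in val x ->
  exists f : {set {u : {set 'I_n} | u \in c}} -> quotient_complex G,
    (forall A B, (f A <= f B) = (A \subset B)) /\
    (forall y, y <= x <-> exists A, y = f A).
Proof.
move=> cx; have [cch xE] := qfaceP cx.
pose T : finType := {u : {set 'I_n} | u \in c}.
have sc (A : {set T}) : ((val @: A : {set {set 'I_n}}) \subset c).
  by apply/subsetP => _ /imsetP[u _ ->]; apply: valP.
exists (fun A => chain_face G (subset_chains (sc A) cch)).
split=> [A B|y]; first rewrite (chain_face_le _ cch _ _ (sc A) (sc B)).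
  apply/idP/idP => [/subsetP AB|]; last exact: imsetS.
  apply/subsetP => u uA.
  by have /imsetP[v vB /val_inj ->] := AB _ (imset_f val uA).
split=> [/(qface_leP _ cx)[b by_ bc]|[A ->]]; last first.
  by apply/(qface_leP _ cx); exists (val @: A) => //; apply: orbit_refl.
exists [set u : T | val u \in b]; apply: val_inj => /=.
have [_ ->] := qfaceP by_; congr (orbit _ _ _); apply/setP => u.
apply/idP/imsetP => [ub|[v]]; last by rewrite inE => ? ->.
by exists (Sub u (subsetP bc _ ub)); rewrite ?inE.
Qed.

Lemma boolean_quotient_complex n (G : {group 'S_n}) :
  boolean_cell_complex (quotient_complex G).
Proof.
move=> x; have [c cx] := qface_ex x; have [f fP] := qface_interval cx.
by eexists; exists f.
Qed.

Lemma nverts_quotient_complex n (G : {group 'S_n}) (x : quotient_complex G)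
    (c : {set {set 'I_n}}) : c \in val x -> nverts x = #|c|.
Proof.
move=> cx; have [f [fle fx]] := qface_interval cx.
by rewrite (nverts_boolean fle fx) card_sig.
Qed.

Definition rows l m : {set {set 'I_(l * m)}} :=
  [set [set j : 'I_(l * m) | (j %/ l)%N == i] | i : 'I_m].

(* The setwise stabiliser of the partition into rows. *)
Definition wreath l m : {group 'S_(l * m)} := 'N(rows l m | 'P^* )%G.

Lemma wreathP l m (s : 'S_(l * m)) : (0 < l)%N ->
  reflect (forall i j : 'I_(l * m),
             (s i %/ l == s j %/ l)%N = (i %/ l == j %/ l)%N)
          (s \in wreath l m).
Proof.
move=> l0.
have rb (j : 'I_(l*m)) : (j %/ l < m)%N by rewrite ltn_divLR // [(m * l)%N]mulnC ltn_ord.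
apply: (iffP idP).
- move=> sW.
  have h (i j : 'I_(l*m)) (t : 'S_(l*m)) : t \in wreath l m -> (i %/ l == j %/ l)%N -> (t i %/ l == t j %/ l)%N.
    rewrite /wreath => tW /eqP ij.
    have R : [set k : 'I_(l*m) | (k %/ l)%N == (i %/ l)%N] \in rows l m.
      by apply/imsetP; exists (Ordinal (rb i)).
    have := astabs_act [set k : 'I_(l*m) | (k %/ l)%N == (i %/ l)%N] tW.
    rewrite R => /imsetP[r _ E].
    have: t i \in [set j : 'I_(l * m) | (j %/ l)%N == r].
      by rewrite -E; apply: imset_f; rewrite inE.
    have: t j \in [set j : 'I_(l * m) | (j %/ l)%N == r].
      by rewrite -E; apply: imset_f; rewrite inE ij.
    by rewrite !inE => /eqP-> /eqP->.
  move=> i j; apply/idP/idP; last exact: h.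
  move/(h _ _ s^-1); rewrite !permK; apply; by rewrite groupV.
- move=> H; rewrite /wreath /= !inE; apply/subsetP => _ /imsetP[r _ ->]; rewrite inE.
  have b : (r * l < l * m)%N by rewrite [(r * l)%N]mulnC ltn_mul2l l0 ltn_ord.
  pose i := Ordinal b.
  apply/imsetP; exists (Ordinal (rb (s i))) => //; apply/setP => k.
  apply/imsetP/idP => [[j]|].
    rewrite !inE => /eqP jr -> /=; have := H j i; rewrite /= mulnK // jr eqxx => ->//.
  rewrite inE /= => /eqP k1; exists (s^-1 k); last by rewrite /= apermE permKV.
  by have := H (s^-1 k) i; rewrite permKV k1 eqxx /= mulnK // inE => <-.
Qed.

(* The complex has only the empty face when l = m = 1. *)
Lemma wreath11_not_collapsible : ~ collapsible (quotient_complex (wreath 1 1)).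
Proof.
case=> v /andP[vb _] _; have [c cv] := qface_ex v.
have [+ _] := qfaceP cv; rewrite inE => /and3P[c0 cT _].
have cE : c = set0.
  apply/setP => u; rewrite inE; apply/negbTE; apply/negP => uc.
  case: (set_0Vmem u) => [u0|[x xu]]; first by rewrite -u0 uc in c0.
  suff uT : u = setT by rewrite -uT uc in cT.
  apply/setP => y; rewrite inE; suff -> : y = x by [].
  by apply: val_inj; case: (y) (x) => [[|?] ?] [[|?] ?].
move/negP: vb; apply; rewrite -lex0; have [d db] := qface_ex (\bot : quotient_complex (wreath 1 1)).
by apply/(qface_leP _ db); exists c => //; rewrite cE sub0set.
Qed.

(* Main.v *)
Require Import Defs.
From mathcomp Require Import all_boot all_order all_fingroup.

(** The idea is geometric.  The quotient by the row-preserving permutations is a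
convex spherical polytope (the points whose coordinates weakly increase along
each row), and permuting the rows fixes a point of it, namely the one in which
the least coordinate of every row is 0 and all others are 1.  Lowering the
least coordinate of every row at equal speed contracts the polytope to that
point, compatibly with the permutations of the rows.  The proof turns this flow
into an acyclic matching.

For a chain [c], call a set a partial transversal when it meets every row at
most once ([ptrans]).  Let [low c] be the largest partial transversal in [c]
(or the empty set) and [high c] the smallest member of [c] that is not one (or
the full set).  The flow makes the least elements of the rows that lie in
[high c] precede everything else in [high c]: that is, it inserts between
[low c] and [high c] a partial transversal meeting all the rows that [high c]
meets.  Such a set is a [splitting].  It always exists ([splitting_exists]),
and any two of them differ by swaps inside rows that fix [c]
([splitting_conj]), so up to the group there is just one way to insert it.  The
faces to which it has already been added (the [full] ones) are thus in
bijection with the other faces, by removing [low c] ([lowerf_inj],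
[lowerf_onto]).  The empty face is matched with the vertex given by the full
transversals, which is the vertex that survives.

The matching is acyclic: if the lower cell of a full face [r] lies in another
full face [s] of the same dimension, then [s] cannot be obtained by adding a
partial transversal, since that would again be a splitting; so [s] contains
fewer partial transversals than [r] ([nptrans_lt]).

The argument needs only that the group preserves a partition into rows, one of
which is not a singleton, and contains the transpositions inside rows
([collapsible_quotient_rows]).  For l > 1 these are the rows of the wreath
product; for l = 1 the group is the full symmetric group and a single row
containing everything serves instead. *)

Set Implicit Arguments.
Unset Strict Implicit.
Unset Printing Implicit Defensive.

(** * Collapsing along an acyclic matching *)

Section AcyclicMatching.
Import Order.Theory.
Local Open Scope order_scope.

(** Here [R] holds the upper cells of the matching, [d r] is the cell matched
with [r], and the bottom cell takes part in the matching: its partner is the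
vertex that remains.  Collapse the pairs by decreasing dimension and, within a
dimension, by increasing [j].  When the turn of [r] comes, a cell properly
above [d r] other than [r] either belongs to a pair of larger dimension or is
an upper cell of the same dimension with smaller [j]; so it is gone, and [d r]
is a free face. *)
Lemma collapsible_acyclic_matching disp (P : finBPOrderType disp) (R : {set P})
    (d : P -> P) (j : P -> nat) :
    {homo @nverts disp P : x y / x < y >-> (x < y)%N} ->
    \bot \notin R ->
    (forall x, x \notin R -> exists2 r, r \in R & d r = x) ->
    {in R, forall r, d r \notin R} ->
    {in R &, injective d} ->
    {in R, forall r, d r < r} ->
    {in R, forall r, nverts r = (nverts (d r)).+1} ->
    {in R &, forall r s, d r < s -> nverts s = nverts r -> s != r ->
      (j s < j r)%N} ->
  collapsible P.
Proof.
move=> nv_lt botR d_onto dR d_inj d_lt nv_d j_lt.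
have [v vR dv] := d_onto _ botR.
have v0 : v != \bot by apply: contraNneq botR => <-.
have vP : vertex v.
  apply/andP; split=> //; apply/forallP => s; apply/implyP => sv.
  apply: contraT => s0; have := nv_lt _ _ sv; rewrite (nv_d _ vR) dv ltnS.
  by rewrite leqNgt nv_lt // lt0x.
(* What is left when the pairs still present are those with upper cell in S. *)
pose K (S : {set P}) := S :|: d @: S.
have KR : K R = setT.
  apply/setP => x; rewrite !inE; case: (boolP (x \in R)) => //= /d_onto[r rR <-].
  exact: imset_f.
have Kv : K [set v] = [set \bot; v] by rewrite /K imset_set1 dv setUC.
exists v => //; rewrite -KR -Kv.
suff collapse (S : {set P}) : v \in S -> S \subset R ->
  connect (@elementary_collapse _ P) (K S) (K [set v]) by exact: collapse.
have [k] := ubnP #|S|; elim: k S => // k IH S /ltnSE Sk vS SR.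
case: (set_0Vmem (S :\ v)) => [S0|[r0 r0S]].
  by rewrite -(setD1K vS) S0 setU0.
have [r1 r1S r1max] := @arg_maxnP _ r0 (mem (S :\ v)) (@nverts _ P) r0S.
have r1P : (r1 \in S :\ v) && (nverts r1 == nverts r1) by rewrite eqxx andbT.
have [r /andP[rS /eqP nr] rmin] := @arg_minnP _ r1
  [pred r | (r \in S :\ v) && (nverts r == nverts r1)] j r1P.
have /setD1P[rv rS'] := rS; have rR := subsetP SR _ rS'.
have dr0 : d r != \bot.
  by apply: contraNneq rv; rewrite -dv => /(d_inj _ _ rR vR) ->.
apply: (connect_trans (y := K (S :\ r))); last first.
  apply: IH; last by apply: subset_trans SR; apply: subD1set.
    by move: Sk; rewrite (cardsD1 r S) rS'.
  by rewrite !inE eq_sym rv.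
apply/connect1/exists_inP; exists (d r).
  by rewrite !inE imset_f ?orbT.
apply/exists_inP; exists r; first by rewrite !inE rS'.
rewrite dr0 d_lt // nv_d // eqxx /=; apply/andP; split; last first.
  apply/eqP/setP => x; rewrite !inE negb_or -andbA.
  have [->|xr] /= := eqVneq x r.
    rewrite andbF; apply/negbTE/imsetP => -[s /setD1P[_ /(subsetP SR) sR] rE].
    by have := dR _ sR; rewrite -rE rR.
  have [->|xdr] /= := eqVneq x (d r).
    apply/negbTE; rewrite negb_or; apply/andP; split.
      by apply: contra (dR _ rR) => /(subsetP SR).
    apply/imsetP => -[s /setD1P[sr /(subsetP SR) sR] /(d_inj _ _ rR sR) rs].
    by rewrite rs eqxx in sr.
  congr (_ || _); apply/imsetP/imsetP => -[s sS xE]; exists s => //.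
    by move: sS; rewrite !inE => /andP[].
  by rewrite !inE sS andbT; apply: contraNneq xdr => <-; rewrite xE.
apply/forall_inP => s sK; apply/implyP => drs; apply: contraT => sr.
have nrs : (nverts r <= nverts s)%N by rewrite nv_d //; apply: nv_lt.
have sv : s != v.
  apply: contraTneq drs => ->; case/andP: vP => _ /forallP/(_ (d r)).
  by rewrite (negPf dr0) implybF.
case/setUP: sK => [sS|/imsetP[t tS sE]].
  have sS' : s \in S :\ v by rewrite !inE sv.
  have ns : nverts s = nverts r.
    by apply/eqP; rewrite eqn_leq nrs andbT nr; apply: r1max.
  have := rmin s; rewrite inE sS' ns nr eqxx => /(_ isT).
  by rewrite leqNgt j_lt // (subsetP SR).
have tR := subsetP SR _ tS.
have tS' : t \in S :\ v.
  rewrite !inE tS andbT; apply: contraTneq drs => tv.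
  by rewrite sE tv dv ltx0.
have := r1max t tS'; rewrite /= -nr nv_d // -sE => /leq_trans/(_ nrs).
by rewrite ltnn.
Qed.

End AcyclicMatching.

(** * Groups that preserve a partition into rows *)

Section RowGroup.
Variables (n : nat) (T : finType) (row : 'I_n -> T) (G : {group 'S_n}).
Hypothesis rowG : forall g x y, g \in G ->
  (row (g x) == row (g y)) = (row x == row y).
Hypothesis tpermG : forall x y, row x = row y -> tperm x y \in G.
Hypothesis row_ninj : ~ injective row.

Implicit Types (U V W A B : {set 'I_n}) (b c : {set {set 'I_n}}) (g : 'S_n).
Implicit Types (x y r s : quotient_complex G).

Local Notation sact := ('P^* )%act.
Local Notation cact := ('P^* ^* )%act.

Lemma mem_sact U g i : (i \in sact U g) = (g^-1%g i \in U).
Proof.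
rewrite -{1}(permKV g i); exact: (mem_imset _ _ (@perm_inj _ g)).
Qed.

Lemma mem_cact c U g : (sact U g \in cact c g) = (U \in c).
Proof. exact: (mem_imset _ _ (act_inj _ g)). Qed.

Definition ptrans U :=
  [forall i in U, forall k in U, (row i == row k) ==> (i == k)].

Lemma ptransP U : reflect {in U &, injective row} (ptrans U).
Proof.
apply: (iffP forall_inP) => [h i k iU kU rik|h i iU].
  by have /forall_inP/(_ k kU)/implyP := h i iU; rewrite rik eqxx => /(_ isT)/eqP.
by apply/forall_inP => k kU; apply/implyP => /eqP/h ->.
Qed.

Lemma ptransS A B : A \subset B -> ptrans B -> ptrans A.
Proof.
move=> /subsetP AB /ptransP hB; apply/ptransP => i k iA kA.
by apply: hB; apply: AB.
Qed.

Lemma ptrans_act U g : g \in G -> ptrans (sact U g) = ptrans U.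
Proof.
have imp V h : h \in G -> ptrans V -> ptrans (sact V h).
  move=> hG /ptransP Vinj; apply/ptransP => i k; rewrite !mem_sact => iV kV rik.
  apply: (@perm_inj _ h^-1%g); apply: Vinj => //; apply/eqP.
  by rewrite rowG ?groupV ?rik.
move=> gG; apply/idP/idP; last exact: imp.
by move/(imp _ g^-1%g); rewrite groupV actK; apply.
Qed.

Definition covers A B := row @: B \subset row @: A.

Lemma coversP A B :
  reflect (forall k, k \in B -> exists2 i, i \in A & row i = row k) (covers A B).
Proof.
apply: (iffP subsetP) => [h k kB|h _ /imsetP[k kB ->]].
  by have /imsetP[i iA ->] := h _ (imset_f row kB); exists i.
by have [i iA <-] := h k kB; apply: imset_f.
Qed.

Lemma covers_act A B g : g \in G -> covers A B -> covers (sact A g) (sact B g).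
Proof.
move=> gG /coversP h; apply/coversP => k; rewrite mem_sact => /h[i iA rik].
exists (g i); first by rewrite mem_sact permK.
by apply/eqP; rewrite -(permKV g k) rowG // rik.
Qed.

(** * The two ends of the splitting range of a chain *)

(** In a chain this union is its own largest term; the empty set stands for the
bottom of the Boolean algebra, which chains omit. *)
Definition low c := \bigcup_(U in c | ptrans U) U.
(** Dually the least term of the intersection, with the full set as the default
of the empty intersection. *)
Definition high c := \bigcap_(U in c | ~~ ptrans U) U.

Lemma low_act c g : g \in G -> low (cact c g) = sact (low c) g.
Proof.
move=> gG; apply/setP => i; rewrite mem_sact.
apply/bigcupP/bigcupP => [[_ /andP[/imsetP[U Uc ->]]]|[U /andP[Uc tU] iU]].
  by rewrite ptrans_act // mem_sact => tU iU; exists U; rewrite ?Uc.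
by exists (sact U g); rewrite ?mem_cact ?ptrans_act ?Uc // mem_sact.
Qed.

Lemma high_act c g : g \in G -> high (cact c g) = sact (high c) g.
Proof.
move=> gG; apply/setP => i; rewrite mem_sact.
apply/bigcapP/bigcapP => h U.
  by move/(_ (sact U g)): h; rewrite mem_cact ptrans_act // mem_sact.
case/andP => /imsetP[V Vc ->]; rewrite ptrans_act // mem_sact => tV.
by apply: h; rewrite Vc.
Qed.

Lemma low_max c U : U \in c -> ptrans U -> U \subset low c.
Proof. by move=> Uc tU; apply: bigcup_sup; rewrite Uc. Qed.

Lemma high_min c U : U \in c -> ~~ ptrans U -> high c \subset U.
Proof. by move=> Uc tU; apply: bigcap_inf; rewrite Uc. Qed.

Lemma chain_cmp c U V : c \in chains n -> U \in c -> V \in c ->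
  (U \subset V) || (V \subset U).
Proof.
rewrite inE => /and3P[_ _ /forall_inP h] Uc Vc.
by have /forall_inP := h U Uc; apply.
Qed.

Lemma low_spec c : c \in chains n ->
  (low c = set0 \/ low c \in c) /\ ptrans (low c).
Proof.
move=> cch; case: (pickP [pred U | (U \in c) && ptrans U]) => [U0 U0P|none].
  have [U /andP[Uc tU] Umax] := arg_maxnP (fun U : {set 'I_n} => #|U|) U0P.
  suff -> : low c = U by split=> //; right.
  apply/eqP; rewrite eqEsubset low_max // andbT.
  apply/bigcupsP => V VP; have /andP[Vc tV] := VP.
  have /orP[//|UV] := chain_cmp cch Vc Uc.
  suff -> : U = V by [].
  by apply/eqP; rewrite eqEcard UV; apply: Umax.
have -> : low c = set0 by apply: big_pred0 => U; apply: none.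
by split; [left|apply/ptransP => i; rewrite inE].
Qed.

(** This is where a row with two elements is needed: it puts the full set, the
top of the Boolean algebra, on the side of [high]. *)
Lemma setT_nptrans : ~~ ptrans setT.
Proof.
apply/negP => /ptransP h; apply: row_ninj => i k; exact: h.
Qed.

Lemma high_spec c : c \in chains n ->
  (high c = setT \/ high c \in c) /\ ~~ ptrans (high c).
Proof.
move=> cch; case: (pickP [pred U | (U \in c) && ~~ ptrans U]) => [U0 U0P|none].
  have [U /andP[Uc tU] Umin] := arg_minnP (fun U : {set 'I_n} => #|U|) U0P.
  suff -> : high c = U by split=> //; right.
  apply/eqP; rewrite eqEsubset high_min //=.
  apply/bigcapsP => V VP; have /andP[Vc tV] := VP.
  have /orP[//|VU] := chain_cmp cch Uc Vc.
  suff -> : V = U by [].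
  by apply/eqP; rewrite eqEcard VU; apply: Umin.
have -> : high c = setT by apply: big_pred0 => U; apply: none.
by split; [left|apply: setT_nptrans].
Qed.

(** Partial transversals are closed under taking subsets, so they form an initial
segment of every chain. *)
Lemma low_high c : c \in chains n -> low c \subset high c.
Proof.
move=> cch; apply/bigcupsP => U /andP[Uc tU]; apply/bigcapsP => V /andP[Vc tV].
have /orP[//|VU] := chain_cmp cch Uc Vc.
by rewrite (ptransS VU tU) in tV.
Qed.

Lemma high_neq0 c : c \in chains n -> high c != set0.
Proof.
case/high_spec => _; apply: contraNneq => ->.
by apply/ptransP => i; rewrite inE.
Qed.

(** The chains that arise from a smaller one by inserting a splitting; nothing
more can be inserted, as [low c] is maximal among the partial transversals
inside [high c]. *)
Definition full c := covers (low c) (high c).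

Lemma full_act c g : g \in G -> full (cact c g) = full c.
Proof.
have imp b h : h \in G -> full b -> full (cact b h).
  by move=> hG; rewrite /full low_act // high_act //; apply: covers_act.
move=> gG; apply/idP/idP; last exact: imp.
by move/(imp _ g^-1%g); rewrite groupV actK; apply.
Qed.

Lemma full_low_mem c : c \in chains n -> full c -> low c \in c.
Proof.
move=> cch fc; have [[l0|//] _] := low_spec cch.
have /set0Pn[i /(coversP _ _ fc)[k]] := high_neq0 cch.
by rewrite l0 inE.
Qed.

(** A smaller partial transversal meets strictly fewer rows, so only the largest
one can meet all those of [high c]. *)
Lemma low_unique c W : c \in chains n -> W \in c -> ptrans W ->
  covers W (high c) -> W = low c.
Proof.
move=> cch Wc tW /coversP cW; have [_ /ptransP lP] := low_spec cch.
have Wl := low_max Wc tW.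
apply/eqP; rewrite eqEsubset Wl; apply/subsetP => k kl.
have [i iW rik] := cW k (subsetP (low_high cch) _ kl).
by rewrite -(lP _ _ (subsetP Wl _ iW) kl rik).
Qed.

(** * Splittings *)

Definition splitting c W :=
  [/\ low c \subset W, W \subset high c, ptrans W & covers W (high c)].

Lemma eq_high b c :
  (forall U, ~~ ptrans U -> (U \in b) = (U \in c)) -> high b = high c.
Proof.
move=> bc; apply: eq_bigl => U; case: (boolP (ptrans U)); rewrite ?andbF //.
by move/bc ->.
Qed.

Lemma high_setU1 c W : ptrans W -> high (W |: c) = high c.
Proof.
move=> tW; apply: eq_high => U tU; rewrite !inE.
by case: eqP tU => // ->; rewrite tW.
Qed.

Lemma high_setD1 c W : ptrans W -> high (c :\ W) = high c.
Proof.
move=> tW; apply: eq_high => U tU; rewrite !inE.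
by case: eqP tU => // ->; rewrite tW.
Qed.

Lemma low_setU1 c W : splitting c W -> low (W |: c) = W.
Proof.
case=> lW _ tW _; apply/eqP; rewrite eqEsubset low_max ?setU11 // andbT.
apply/bigcupsP => U; rewrite !inE => /andP[/orP[/eqP-> //|Uc] tU].
by apply: subset_trans lW; apply: low_max.
Qed.

Lemma splitting_full c W : splitting c W -> full (W |: c).
Proof.
move=> sW; have [_ _ tW cW] := sW.
by rewrite /full low_setU1 // high_setU1.
Qed.

(** The members of [c] that are partial transversals lie below [W], the others
above it. *)
Lemma splitting_chain c W : c \in chains n -> splitting c W ->
  W |: c \in chains n.
Proof.
move=> cch [lW Wh tW cW].
have W0 : W != set0.
  have /set0Pn[i /(coversP _ _ cW)[k kW _]] := high_neq0 cch.
  by apply/set0Pn; exists k.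
have WT : W != setT by apply: contraTneq tW => ->; apply: setT_nptrans.
have Wcmp U : U \in c -> (U \subset W) || (W \subset U).
  move=> Uc; case: (boolP (ptrans U)) => tU; apply/orP; [left|right].
    by apply: subset_trans lW; apply: low_max.
  by apply: subset_trans Wh _; apply: high_min.
have := cch; rewrite !inE => /and3P[c0 cT _].
rewrite ![_ == W]eq_sym (negPf W0) (negPf WT) (negPf c0) (negPf cT) /=.
apply/forall_inP => U UWc; apply/forall_inP => V VWc.
move: UWc VWc; rewrite !inE.
case/orP=> [/eqP->|Uc]; case/orP=> [/eqP->|Vc]; rewrite ?subxx //.
- by rewrite orbC Wcmp.
- exact: Wcmp.
- exact: chain_cmp Uc Vc.
Qed.

(** Complete [low c] by one element of [high c] in each row that [high c] meets
and [low c] does not. *)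
Lemma splitting_exists c : c \in chains n -> exists W, splitting c W.
Proof.
move=> cch; have [_ /ptransP lP] := low_spec cch.
pose rep t := [pick k in high c | row k == t].
pose N := [set k in high c |
  (row k \notin row @: low c) && (rep (row k) == Some k)].
exists (low c :|: N); split.
- exact: subsetUl.
- by rewrite subUset low_high //; apply/subsetP => k; rewrite inE => /andP[].
- apply/ptransP => i k; rewrite !inE.
  case/orP=> [il|/and3P[_ iN /eqP ri]]; case/orP=> [kl|/and3P[_ kN /eqP rk]] rik.
  + exact: lP.
  + by rewrite -rik imset_f in kN.
  + by rewrite rik imset_f in iN.
  + by move: ri; rewrite rik rk => -[].
apply/coversP => k kh; case: (boolP (row k \in row @: low c)).
  by case/imsetP => i il ->; exists i; rewrite // inE il.
move=> kl; have: rep (row k) = rep (row k) by [].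
rewrite {2}/rep; case: pickP => [i /andP[ih /eqP rik] ri|/(_ k)]; last first.
  by rewrite kh eqxx.
by exists i; rewrite // !inE ih rik ri kl eqxx orbT.
Qed.

(** Removing a splitting loses no information modulo the group.  Two splittings
choose representatives of the same rows; where the choices [i] and [m] differ,
both lie in [high c] and neither in [low c], so the transposition of [i] and
[m] fixes each member of [c] and brings the two splittings closer. *)
Lemma splitting_conj c W W' : splitting c W -> splitting c W' ->
  exists2 g, g \in G & cact c g = c /\ sact W g = W'.
Proof.
have [k] := ubnP #|W :\: W'|; elim: k W => // k IH W /ltnSE Wk sW sW'.
have [lW Wh /ptransP tW cW] := sW; have [lW' Wh' /ptransP tW' cW'] := sW'.
case: (set_0Vmem (W :\: W')) => [WW'|[i /setDP[iW iW']]].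
  exists 1%g => //; rewrite !act1; split=> //.
  have {}WW' : W \subset W' by rewrite -setD_eq0 WW'.
  apply/eqP; rewrite eqEsubset WW' /=; apply/subsetP => m mW'.
  have [i iW rim] := coversP _ _ cW m (subsetP Wh' _ mW').
  by rewrite -(tW' _ _ (subsetP WW' _ iW) mW' rim).
have [m mW' rmi] := coversP _ _ cW' i (subsetP Wh _ iW).
have mW : m \notin W by apply: contra iW' => mW; rewrite (tW _ _ iW mW (esym rmi)).
have ih := subsetP Wh _ iW; have mh := subsetP Wh' _ mW'.
set g := tperm i m; have gG : g \in G by apply: tpermG.
have sfix U : (i \in U) = (m \in U) -> sact U g = U.
  move=> imU; apply/setP => p; rewrite mem_sact tpermV /g.
  by case: tpermP => [->|->|].
have gl : sact (low c) g = low c.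
  apply: sfix; rewrite (contraNF (subsetP lW' i) iW').
  by rewrite (contraNF (subsetP lW m) mW).
have gh : sact (high c) g = high c.
  by apply: sfix; rewrite ih mh.
have gU U : U \in c -> sact U g = U.
  move=> Uc; apply: sfix; case: (boolP (ptrans U)) => tU.
    have /subsetP Ul := low_max Uc tU; apply/idP/idP => /Ul.
      by move/(subsetP lW'); rewrite (negPf iW').
    by move/(subsetP lW); rewrite (negPf mW).
  have /subsetP hU := high_min Uc tU.
  by rewrite (hU i ih) (hU m mh).
have gc : cact c g = c.
  rewrite -[RHS]imset_id; exact: eq_in_imset gU.
have sgW : splitting c (sact W g).
  rewrite /splitting -{1}gl -gh ptrans_act //; split=> //.
  - exact: imsetS.
  - exact: imsetS.
  - exact/ptransP.
  - exact: covers_act.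
have [|g' g'G [g'c g'W]] := IH _ _ sgW sW'.
  apply: leq_trans Wk; apply: proper_card; apply/properP; split.
    apply/subsetP => p; rewrite !inE mem_sact tpermV /g => /andP[pW'].
    by case: tpermP pW' => [->|->|_ _ ->]; rewrite ?(negPf mW) ?mW'.
  exists i; first by rewrite inE iW'.
  by rewrite !inE mem_sact tpermV tpermL (negPf mW) andbF.
by exists (g * g')%g; rewrite ?groupM // !actM gc g'c g'W.
Qed.

(** * The matching on chains and on faces *)

Definition lower c := c :\ low c.

Lemma lower_act c g : g \in G -> lower (cact c g) = cact (lower c) g.
Proof.
move=> gG; apply/setP => U; rewrite -(actKV ('P^* )%act g U) mem_cact !inE mem_cact.
by rewrite low_act // (inj_eq (act_inj _ g)).
Qed.

Lemma lower_splitting c : c \in chains n -> full c -> splitting (lower c) (low c).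
Proof.
move=> cch fc; have [_ tl] := low_spec cch.
rewrite /splitting high_setD1 //; split=> //; last exact: low_high.
apply/bigcupsP => U; rewrite !inE => /andP[/andP[_ Uc] tU]; exact: low_max.
Qed.

Lemma lower_chain c : c \in chains n -> lower c \in chains n.
Proof. exact/subset_chains/subD1set. Qed.

(** If the lower chain were full, its largest partial transversal would meet all
the rows of [high c], contradicting [low_unique] in [c]. *)
Lemma lower_nfull c : c \in chains n -> full c -> ~~ full (lower c).
Proof.
move=> cch fc; apply/negP => fl; have lch := lower_chain cch.
have [_ tl] := low_spec cch.
have := full_low_mem lch fl; have [_ tll] := low_spec lch.
rewrite /lower !inE => /andP[/eqP lll llc]; apply: lll.
by apply: low_unique => //; rewrite -(high_setD1 c tl).
Qed.

Lemma lowerK c W : ~~ full c -> c \in chains n -> splitting c W ->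
  lower (W |: c) = c.
Proof.
move=> fc cch sW; rewrite /lower low_setU1 // setU1K //.
apply: contra fc => Wc; have := splitting_full sW.
by rewrite (setUidPr _) // sub1set.
Qed.


Lemma mem_face x c c' : c \in val x -> c' \in val x ->
  exists2 g, g \in G & c' = cact c g.
Proof.
move=> /qfaceP[_ ->] /orbitP[g gG <-]; by exists g.
Qed.

Lemma face_act x c g : g \in G -> c \in val x -> cact c g \in val x.
Proof. by move=> gG /qfaceP[_ ->]; apply: mem_orbit. Qed.

Lemma face_eq x y c : c \in val x -> c \in val y -> x = y.
Proof.
by move=> /qfaceP[_ xE] /qfaceP[_ yE]; apply: val_inj; rewrite xE yE.
Qed.

Definition rep x := xchoose (qface_ex x).

Lemma rep_mem x : rep x \in val x.
Proof. exact: xchooseP. Qed.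

Definition fullf := [set x | full (rep x)].

Lemma mem_fullf x c : c \in val x -> (x \in fullf) = full c.
Proof.
move=> cx; rewrite inE; have [g gG ->] := mem_face (rep_mem x) cx.
by rewrite full_act.
Qed.

Definition lowerf x : quotient_complex G :=
  chain_face G (lower_chain (proj1 (qfaceP (rep_mem x)))).

Lemma lowerf_mem x c : c \in val x -> lower c \in val (lowerf x).
Proof.
move=> cx; have [g gG ->] := mem_face (rep_mem x) cx.
by rewrite lower_act //; apply: mem_orbit.
Qed.

Definition nptrans x := #|[set U in rep x | ptrans U]|.

Lemma nptransE x c : c \in val x -> nptrans x = #|[set U in c | ptrans U]|.
Proof.
move=> cx; have [g gG ->] := mem_face (rep_mem x) cx.
rewrite /nptrans -(card_imset _ (act_inj ('P^* )%act g)); apply: eq_card => U.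
rewrite -(actKV ('P^* )%act g U) (mem_imset _ _ (act_inj _ g)) !inE.
by rewrite mem_cact (ptrans_act (sact U g^-1%g) gG).
Qed.

(** Representatives of two faces with the same lower cell can be chosen to have
the same lower chain; they are then two splittings of it. *)
Lemma lowerf_inj : {in fullf &, injective lowerf}.
Proof.
move=> r s rF sF rs; have [c cr] := qface_ex r.
have [c0 c0s] := qface_ex s; have := lowerf_mem cr; rewrite rs => lc.
have [g gG cc0] := mem_face (lowerf_mem c0s) lc.
move: (face_act gG c0s); rewrite -lower_act // in cc0.
move: (cact c0 g) cc0 => c' cc' c's.
have [cch _] := qfaceP cr; have [c'ch _] := qfaceP c's.
have fc : full c by rewrite -(mem_fullf cr).
have fc' : full c' by rewrite -(mem_fullf c's).
have sc := lower_splitting cch fc; have := lower_splitting c'ch fc'.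
rewrite -cc' => sc'; have [h hG [hb hW]] := splitting_conj sc sc'.
apply: (face_eq (c := c')) => //; rewrite -(setD1K (full_low_mem c'ch fc')).
rewrite -[c' :\ _]/(lower c') -cc' -hb -hW.
suff -> : sact (low c) h |: cact (lower c) h = cact c h by apply: face_act.
by rewrite -[in RHS](setD1K (full_low_mem cch fc)) [RHS]imsetU1.
Qed.

Lemma nverts_lt :
  {homo @nverts _ (quotient_complex G) : x y / (x < y)%O >-> x < y}.
Proof.
move=> x y; rewrite Order.POrderTheory.lt_neqAle => /andP[xy lexy].
have [d dy] := qface_ex y; have [c cx cd] := qface_leP _ dy lexy.
rewrite (nverts_quotient_complex cx) (nverts_quotient_complex dy).
apply: proper_card; rewrite properEneq cd andbT.
by apply: contraNneq xy => cdE; rewrite -cdE in dy; rewrite (face_eq cx dy).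
Qed.

Lemma nverts_lowerf r : r \in fullf -> nverts r = (nverts (lowerf r)).+1.
Proof.
have [c cr] := qface_ex r; have [cch _] := qfaceP cr.
rewrite (mem_fullf cr) => fc.
rewrite (nverts_quotient_complex cr) (nverts_quotient_complex (lowerf_mem cr)).
by rewrite (cardsD1 (low c)) full_low_mem.
Qed.

Lemma lowerf_lt r : r \in fullf -> (lowerf r < r)%O.
Proof.
move=> rF; rewrite Order.POrderTheory.lt_neqAle; apply/andP; split.
  by apply/eqP => rE; have := nverts_lowerf rF; rewrite rE; apply: n_Sn.
have [c cr] := qface_ex r; apply/(qface_leP _ cr); exists (lower c).
  exact: lowerf_mem.
exact: subD1set.
Qed.

Lemma bot_nfull : (Order.bottom : quotient_complex G) \notin fullf.
Proof.
have c0 : set0 \in val (Order.bottom : quotient_complex G) by apply: orbit_refl.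
have [cch _] := qfaceP c0.
rewrite (mem_fullf c0); apply/negP => /(full_low_mem cch).
by rewrite inE.
Qed.

Lemma lowerf_onto x : x \notin fullf -> exists2 r, r \in fullf & lowerf r = x.
Proof.
have [c cx] := qface_ex x; have [cch _] := qfaceP cx.
rewrite (mem_fullf cx) => fc; have [W sW] := splitting_exists cch.
have Wch := splitting_chain cch sW.
have Wr : W |: c \in val (chain_face G Wch) by apply: orbit_refl.
exists (chain_face G Wch); first by rewrite (mem_fullf Wr) splitting_full.
apply: (face_eq (c := c)) => //; rewrite -{1}(lowerK fc cch sW).
exact: lowerf_mem.
Qed.

Lemma lowerf_nfull r : r \in fullf -> lowerf r \notin fullf.
Proof.
have [c cr] := qface_ex r; have [cch _] := qfaceP cr.
by rewrite (mem_fullf cr) (mem_fullf (lowerf_mem cr)); apply: lower_nfull.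
Qed.

(** Acyclicity.  Write [s] as the lower chain [b] of [r] with one more set [X].
If [X] is not a partial transversal, [s] has those of [b], one fewer than [r].
Otherwise [high] is unchanged, and as [s] is full its largest partial
transversal meets all the rows of [high]; by [low_unique] it is not in [b], so
it is [X], and [s] has the same lower cell as [r]. *)
Lemma nptrans_lt r s : r \in fullf -> s \in fullf -> (lowerf r < s)%O ->
  nverts s = nverts r -> s != r -> nptrans s < nptrans r.
Proof.
move=> rF sF /Order.POrderTheory.ltW rs nsr srn.
have [c' c's] := qface_ex s; have [b br bc'] := qface_leP _ c's rs.
have [c0 c0r] := qface_ex r.
have [g gG bE] := mem_face (lowerf_mem c0r) br.
rewrite -lower_act // in bE; move: (face_act gG c0r) bE.
move: (cact c0 g) => c cr bE {c0 c0r g gG br}.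
have [cch _] := qfaceP cr; have [c'ch _] := qfaceP c's.
have fc : full c by rewrite -(mem_fullf cr).
have fc' : full c' by rewrite -(mem_fullf c's).
have lc := full_low_mem cch fc; have [_ tl] := low_spec cch.
have cE : c = low c |: b by rewrite bE setD1K.
have lb : low c \notin b by rewrite bE !inE eqxx.
have [X Xb c'E] : exists2 X, X \notin b & c' = X |: b.
  have : #|c' :\: b| == 1.
    rewrite cardsDS // -(nverts_quotient_complex c's) nsr.
    by rewrite (nverts_quotient_complex cr) {1}cE cardsU1 lb addnK.
  case/cards1P => X XE; have : X \in c' :\: b by rewrite XE set11.
  rewrite inE => /andP[Xb _]; exists X => //.
  by rewrite -XE setUC -{1}(setID c' b) (setIidPr bc').
rewrite (nptransE cr) (nptransE c's); case: (boolP (ptrans X)) => tX; last first.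
  apply: proper_card; apply/properP; split.
    apply/subsetP => U; rewrite c'E cE !inE.
    have [->|_] /= := eqVneq U X; first by rewrite (negPf tX) andbF.
    by case/andP => ->; rewrite orbT.
  exists (low c); rewrite !inE ?lc // c'E !inE (negPf lb) tl andbT orbF.
  by apply: contraNneq tX => <-.
have hc' : high c' = high c by rewrite c'E cE !high_setU1.
have lowX : low c' = X.
  have := full_low_mem c'ch fc'; rewrite {2}c'E !inE => /orP[/eqP//|l'b].
  have l'c : low c' \in c by rewrite cE !inE l'b orbT.
  have [_ tl'] := low_spec c'ch; move: lb.
  by rewrite -(low_unique cch l'c tl') ?l'b // -hc'.
have dE : lowerf s = lowerf r.
  apply: (face_eq (c := b)); last by rewrite bE lowerf_mem.
  have -> : b = lower c' by rewrite /lower lowX c'E setU1K.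
  exact: lowerf_mem.
by rewrite (lowerf_inj sF rF dE) eqxx in srn.
Qed.

Theorem collapsible_quotient_rows : collapsible (quotient_complex G).
Proof.
apply: (collapsible_acyclic_matching nverts_lt bot_nfull lowerf_onto
  lowerf_nfull lowerf_inj lowerf_lt nverts_lowerf) nptrans_lt.
Qed.

End RowGroup.

Unset Implicit Arguments.

Theorem theorem4p1 (l m : nat) (hl : (0 < l)%N) (hm : (0 < m)%N)
  (hlm : (1 < l * m)%N) :
  collapsible (quotient_complex (wreath l m)).
Proof.
have [l1|l_gt1] := leqP l 1.
  have {hl l1} l1 : l = 1 by apply/eqP; rewrite eqn_leq l1 hl.
  subst l; apply: (@collapsible_quotient_rows _ unit (fun=> tt)) => //.
    move=> i k _; apply/wreathP => // p q; rewrite !divn1.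
    exact: (inj_eq (inj_comp val_inj perm_inj)).
  move/(_ (Ordinal (ltnW hlm)) (Ordinal hlm) erefl) => /(congr1 val) //.
pose row (i : 'I_(l * m)) : 'I_(l * m) :=
  Ordinal (leq_ltn_trans (leq_div i l) (ltn_ord i)).
have rowE i k : (row i == row k) = (i %/ l == k %/ l) by [].
apply: (@collapsible_quotient_rows _ _ row).
- by move=> g i k /(wreathP _ hl) gW; rewrite !rowE gW.
- move=> i k /eqP; rewrite rowE => /eqP ik; apply/wreathP => // p q.
  have tE x : tperm i k x %/ l = x %/ l by case: tpermP => [->|->|].
  by rewrite !tE.
- move/(_ (Ordinal (ltnW hlm)) (Ordinal hlm)) => inj.
  have /inj/(congr1 val) // : row (Ordinal (ltnW hlm)) = row (Ordinal hlm).
  by apply: val_inj; rewrite /= div0n divn_small.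
Qed.
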